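(* Let $K$ be a field of characteristic zero, $R=K[X_1,\ldots,X_n]$, and let $M$ be a holonomic left $A_n(K)$-module. Then \[\dim_K H^n(\partial_1,\ldots,\partial_n;M)\ge \sharp\,\mathrm{mIso}_R(M).\]
   Context: $A_n(K)=K\langle X_1,\ldots,X_n,\partial_1,\ldots,\partial_n\rangle$ is the Weyl algebra, containing $R$. The set $\mathrm{Ass}_R(M)$ of associated primes of $M$ as an $R$-module is finite. A prime $P$ is a maximal isolated associated prime of $M$ if $P$ is a maximal ideal of $R$ and also a minimal prime of $M$ (minimal in $\mathrm{Ass}_R(M)$); $\mathrm{mIso}_R(M)$ denotes the set of these. $H^n(\partial_1,\ldots,\partial_n;M)=M/(\partial_1M+\cdots+\partial_nM)$ is the top De Rham cohomology of $M$ (top cohomology of the Koszul cochain complex of $M$ with respect to $\partial_1,\ldots,\partial_n$). *)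

(* Defs.v *)
From HB Require Import structures.
From mathcomp Require Import all_boot all_order all_algebra.
From mathcomp Require Import mpoly.
Set Implicit Arguments. Unset Strict Implicit. Unset Printing Implicit Defensive.
Import Order.TTheory GRing.Theory.
Local Open Scope ring_scope.

(* A left module over the Weyl algebra A_n(K) = K<X_1..X_n, d_1..d_n> is a
   K-vector space M together with K-linear operators xop i (action of X_i)
   and dop i (action of d_i) satisfying the defining relations of A_n(K). *)
Definition weyl_module_rel (K : fieldType) (n : nat) (M : lmodType K)
  (xop dop : 'I_n -> {linear M -> M}) : Prop :=
  [/\ forall i j v, xop i (xop j v) = xop j (xop i v),
      forall i j v, dop i (dop j v) = dop j (dop i v) &
      forall i j v, dop i (xop j v) - xop j (dop i v) = (if i == j then v else 0)].

Section Weyl.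
Variables (K : fieldType) (n : nat) (M : lmodType K)
  (xop dop : 'I_n -> {linear M -> M}).

Definition wapp (w : seq ('I_n * bool)) (v : M) : M :=
  foldr (fun a u => if a.2 then dop a.1 u else xop a.1 u) v w.

(* B_k . span(S) where B_k is the Bernstein filtration (span of words of
   length <= k in the X_i, d_i) and S : 'I_g -> M a finite family *)
Definition inBS (g : nat) (S : 'I_g -> M) (k : nat) (v : M) : Prop :=
  exists (m : nat) (c : 'I_m -> K) (w : 'I_m -> seq ('I_n * bool)) (s : 'I_m -> 'I_g),
    (forall i, size (w i) <= k)%N /\ v = \sum_(i < m) c i *: wapp (w i) (S (s i)).

Definition dim_le (V : M -> Prop) (N : nat) : Prop :=
  forall (m : nat) (u : 'I_m -> M), (N < m)%N -> (forall i, V (u i)) ->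
    exists c : 'I_m -> K, (exists i, c i != 0) /\ \sum_(i < m) c i *: u i = 0.

(* holonomic: finitely generated with d(M) <= n (equivalently, by Bernstein's
   inequality, d(M) = n or M = 0), measured with the good filtration
   B_k . span(S) of a finite generating family S *)
Definition holonomic : Prop :=
  exists (g : nat) (S : 'I_g -> M),
    (forall v, exists k, inBS S k v) /\
    exists C : nat, forall k, dim_le (inBS S k) (C * k.+1 ^ n).

Definition mono_act (mm : 'X_{1..n}) (v : M) : M :=
  foldr (fun i u => iter (mm i) (xop i) u) v (enum 'I_n).

Definition ract (p : {mpoly K[n]}) (v : M) : M :=
  \sum_(mm <- msupp p) p@_mm *: mono_act mm v.

Definition is_ideal (I : {mpoly K[n]} -> Prop) : Prop :=
  [/\ I 0, (forall p q, I p -> I q -> I (p + q)) &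
      (forall p q, I q -> I (p * q))].

Definition is_prime_ideal (I : {mpoly K[n]} -> Prop) : Prop :=
  [/\ is_ideal I, ~ I 1 & forall p q, I (p * q) -> I p \/ I q].

Definition is_maximal_ideal (I : {mpoly K[n]} -> Prop) : Prop :=
  [/\ is_ideal I, ~ I 1 &
      forall J, is_ideal J -> (forall p, I p -> J p) ->
        J 1 \/ (forall p, J p <-> I p)].

Definition assoc_prime (P : {mpoly K[n]} -> Prop) : Prop :=
  is_prime_ideal P /\ exists v : M, forall p, P p <-> ract p v = 0.

Definition max_isolated (P : {mpoly K[n]} -> Prop) : Prop :=
  [/\ is_maximal_ideal P, assoc_prime P &
      forall Q, assoc_prime Q -> (forall p, Q p -> P p) -> forall p, P p -> Q p].

(* v_1..v_k are K-linearly independent in H^n = M / (d_1 M + ... + d_n M) *)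
Definition indep_mod_derivs (k : nat) (v : 'I_k -> M) : Prop :=
  forall c : 'I_k -> K,
    (exists w : 'I_n -> M, \sum_(j < k) c j *: v j = \sum_(i < n) dop i (w i)) ->
    forall j, c j = 0.

End Weyl.

(* Main.v *)
Require Import Defs.
From HB Require Import structures.
From mathcomp Require Import all_boot all_order all_algebra.
From mathcomp Require Import mpoly boolp ring zify generic_quotient ring_quotient.
Set Implicit Arguments. Unset Strict Implicit. Unset Printing Implicit Defensive.
Import Order.TTheory GRing.Theory.
Local Open Scope ring_scope.

(* Let P be a maximal isolated associated prime of M, with R the polynomial ring.
   Since R is noetherian and no associated prime of M lies strictly inside P,
   every element of M is the sum of an element on which P acts nilpotently and of
   an element killed by some f outside P. Both kinds of elements form submodules
   stable under the derivations, and they meet in 0. Hence M splits off its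
   P-torsion part N, and for each P in the list it suffices to show that a
   generator v with annihilator P does not lie in the sum of the d_i N.
   By Zariski's lemma P contains, for every i, a polynomial g_i in X_i alone, and
   a g_i of least degree is coprime to its derivative. Since
   [d_i, g_i] = g_i'(X_i) acts invertibly on N, Kashiwara's argument gives
   N = ker g_i (+) d_i N, with d_i injective on N, without assuming K algebraically
   closed. Splitting off the variables one after the other shows that no nonzero
   v in the common kernel of the g_i is a sum of derivatives. *)

(** * The polynomial action *)

Section PolynomialAction.
Variables (K : fieldType) (n : nat) (M : lmodType K).
Variables (xop dop : 'I_n -> {linear M -> M}).
Hypothesis hW : weyl_module_rel xop dop.

Local Notation mono_on s m v := (foldr (fun i u => iter (m i) (xop i) u) v s).

Lemma iter_xopC i j a b v :
  iter a (xop i) (iter b (xop j) v) = iter b (xop j) (iter a (xop i) v).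
Proof.
case: hW => xC _ _.
have xCi u : xop i (iter b (xop j) u) = iter b (xop j) (xop i u).
  by elim: b => //= b IH; rewrite xC IH.
by elim: a => //= a ->; rewrite xCi.
Qed.

Lemma mono_act_linear (m : 'X_{1..n}) : linear (mono_act xop m).
Proof.
rewrite /mono_act => a u v; elim: (enum _) => //= i s ->.
by elim: (m i) => //= k ->; rewrite linearP.
Qed.

HB.instance Definition _ m :=
  GRing.isLinear.Build K M M _ (mono_act xop m) (mono_act_linear m).

Lemma mono_act0 v : mono_act xop 0%MM v = v.
Proof. by rewrite /mono_act; elim: (enum _) => //= i s ->; rewrite mnm0E. Qed.

Lemma mono_actD m1 m2 v :
  mono_act xop (m1 + m2)%MM v = mono_act xop m1 (mono_act xop m2 v).
Proof.
rewrite /mono_act.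
have C i k s u : iter k (xop i) (mono_on s m1 u) = mono_on s m1 (iter k (xop i) u).
  by elim: s => //= j s IH; rewrite iter_xopC IH.
elim: (enum _) => //= i s ->.
by rewrite mnmDE iterD C.
Qed.

Lemma mono_act1 i v : mono_act xop U_(i)%MM v = xop i v.
Proof.
rewrite /mono_act.
suff H s : uniq s -> mono_on s U_(i)%MM v = if i \in s then xop i v else v.
  by rewrite H ?enum_uniq // mem_enum.
elim: s => //= j s IH /andP[js us]; rewrite IH // inE mnm1E.
by case: eqVneq => [->|_] //=; rewrite (negPf js).
Qed.

(** The sum may run over any larger list of monomials, because the extra coefficients vanish;
    polynomials with different supports can then be compared termwise. *)
Lemma ractE (r : seq 'X_{1..n}) p v : uniq r -> {subset msupp p <= r} ->
  ract xop p v = \sum_(m <- r) p@_m *: mono_act xop m v.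
Proof.
move=> ur sr; rewrite (bigID (fun m => m \in msupp p)) /= [X in _ + X]big1 ?addr0.
  rewrite -big_filter; apply: perm_big; apply: uniq_perm.
  - exact: msupp_uniq.
  - exact: filter_uniq.
  by move=> m; rewrite mem_filter; case: (boolP (m \in msupp p)) => // /sr ->.
by move=> m; rewrite -mcoeff_eq0 => /eqP ->; rewrite scale0r.
Qed.

Lemma ract_linear p : linear (ract xop p).
Proof.
move=> a u v; rewrite /ract scaler_sumr -big_split; apply: eq_bigr => m _ /=.
by rewrite linearP scalerDr !scalerA mulrC.
Qed.

HB.instance Definition _ p :=
  GRing.isLinear.Build K M M _ (ract xop p) (ract_linear p).

Lemma ractP a p q v : ract xop (a *: p + q) v = a *: ract xop p v + ract xop q v.
Proof.
pose r := undup (msupp p ++ msupp q ++ msupp (a *: p + q)).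
have ur : uniq r by apply: undup_uniq.
rewrite !(@ractE r) //; try by move=> m mp; rewrite mem_undup !mem_cat mp ?orbT.
rewrite scaler_sumr -big_split; apply: eq_bigr => m _ /=.
by rewrite mcoeffD mcoeffZ scalerDl scalerA.
Qed.

Lemma ractD p q v : ract xop (p + q) v = ract xop p v + ract xop q v.
Proof. by rewrite -[p]scale1r ractP !scale1r. Qed.

Lemma ract0 v : ract xop 0 v = 0.
Proof. by apply: (addrI (ract xop 0 v)); rewrite -ractD !addr0. Qed.

Lemma ractZ a p v : ract xop (a *: p) v = a *: ract xop p v.
Proof. by rewrite -[a *: p]addr0 ractP ract0 addr0. Qed.

Lemma ractX m v : ract xop 'X_[m] v = mono_act xop m v.
Proof. by rewrite /ract msuppX big_seq1 mcoeffX eqxx scale1r. Qed.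

Lemma ractC a v : ract xop a%:MP v = a *: v.
Proof. by rewrite -[a%:MP]mulr1 mul_mpolyC ractZ -mpolyX0 ractX mono_act0. Qed.

Lemma ract1 v : ract xop 1 v = v.
Proof. by rewrite -mpolyC1 ractC scale1r. Qed.

Lemma ractXM m p v : ract xop ('X_[m] * p) v = mono_act xop m (ract xop p v).
Proof.
elim/mpolyind: p => [|c l p _ _ IHp]; first by rewrite mulr0 !ract0 linear0.
rewrite mulrDr !ractD -scalerAr !ractZ IHp linearD linearZ /=.
by rewrite -mpolyXD !ractX mono_actD.
Qed.

Lemma ractM p q v : ract xop (p * q) v = ract xop p (ract xop q v).
Proof.
elim/mpolyind: p => [|c m p _ _ IHp]; first by rewrite mul0r !ract0.
by rewrite mulrDl !ractD IHp -scalerAl !ractZ ractXM ractX.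
Qed.

End PolynomialAction.

(** * Dickson's lemma and ascending chains of ideals *)

Lemma exists_minimal (T : Type) (Q : T -> Prop) (g : T -> nat) :
  (exists x, Q x) -> exists2 x, Q x & forall y, Q y -> (g x <= g y)%N.
Proof.
case=> x; move: {2}(g x) (leqnn (g x)) => b; elim: b x => [|b IH] x.
  by rewrite leqn0 => /eqP gx Qx; exists x => // y _; rewrite gx.
move=> gx Qx; have [[y [Qy gy]]|H] := EM (exists y, Q y /\ (g y < g x)%N).
  by apply: (IH y) => //; rewrite -ltnS (leq_trans gy).
by exists x => // y Qy; rewrite leqNgt; apply/negP => gy; apply: H; exists y.
Qed.

Lemma nat_nondecreasing_subseq (g : nat -> nat) :
  exists2 phi : nat -> nat, {homo phi : a b / (a < b)%N} &
    {homo g \o phi : a b / (a <= b)%N}.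
Proof.
(* Past any [N] some index attains the minimum of all later values of [g]; iterating this choice
   gives the subsequence. *)
have H N : exists j, (N < j)%N /\ forall l, (N < l)%N -> (g j <= g l)%N.
  have [|j Nj Hj] := @exists_minimal _ (fun j => N < j)%N g; last by exists j.
  by exists N.+1; apply: ltnSn.
have [F HF] := choice H.
pose phi := fix phi k := if k is k'.+1 then F (phi k') else F 0%N.
have phiS k : (phi k < phi k.+1)%N by case: (HF (phi k)).
exists phi.
  by apply: (@homo_ltn _ _ (fun a b => a < b)%N) => //; apply: ltn_trans.
apply: (@homo_leq _ _ (fun a b => a <= b)%N) => // [|k]; first exact: leq_trans.
case: k => [|k] /=.
  by case: (HF 0%N) => h1; apply; apply: (ltn_trans h1); case: (HF (F 0%N)).
by case: (HF (phi k)) => h1; apply; apply: (ltn_trans h1); case: (HF (F (phi k))).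
Qed.

(** Passing to a subsequence once for each coordinate makes all exponents nondecreasing along it;
    its first two terms are then comparable. *)
Lemma dickson (n : nat) (f : nat -> 'X_{1..n}) :
  exists i j, (i < j)%N /\ (f i <= f j)%MM.
Proof.
suff [phi phiI H] : exists2 phi : nat -> nat, {homo phi : a b / (a < b)%N} &
    forall i, i \in enum 'I_n -> {homo (fun a => f (phi a) i) : a b / (a <= b)%N}.
  exists (phi 0%N), (phi 1%N); split; first exact: phiI.
  by apply/mnm_lepP => i; apply: H; rewrite // mem_enum.
elim: (enum _) => [|i s [phi phiI IH]]; first by exists id.
have [psi psiI Hpsi] := nat_nondecreasing_subseq (fun a => f (phi a) i).
exists (phi \o psi) => [a b ab|j]; first by apply/phiI/psiI.
rewrite inE => /orP[/eqP->|js a b ab]; first exact: Hpsi.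
apply: IH => //; move: ab; rewrite leq_eqVlt => /orP[/eqP->//|/psiI/ltnW//].
Qed.

Section Noetherian.
Variables (K : fieldType) (n : nat).
Local Notation R := {mpoly K[n]}.
Implicit Types (I : nat -> R -> Prop) (p q : R).

Lemma idealB (I : R -> Prop) p q : is_ideal I -> I p -> I q -> I (p - q).
Proof.
by case=> _ ID IM Ip Iq; apply: ID => //; rewrite -mulN1r; apply: IM.
Qed.

(** One division step: the term [r] is chosen so that [r * q] has the same leading term as [p], and
    the two cancel. *)
Lemma mlead_reduce p q : p != 0 -> q != 0 -> (mlead q <= mlead p)%MM ->
  exists r, let s := p - r * q in s = 0 \/ (mlead s < mlead p)%O.
Proof.
move=> p0 q0 le; pose m := (mlead p - mlead q)%MM.
have mE : (m + mlead q = mlead p)%MM by rewrite addmC addmBA // addmC addmK.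
pose r := (mleadc p / mleadc q) *: 'X_[m].
have lq : mleadc q != 0 by rewrite mleadc_eq0.
have lp : mleadc p != 0 by rewrite mleadc_eq0.
have r0 : mleadc p / mleadc q != 0 by rewrite mulf_neq0 ?invr_eq0.
have X0 : 'X_[m] != 0 :> R by rewrite -mleadc_eq0 mleadXm mcoeffX eqxx oner_eq0.
exists r => /=; set s := p - _; have [|s0] := eqVneq s 0; [by left | right].
have le_s : (mlead s <= mlead p)%O.
  rewrite (le_trans (mleadB_le _ _)) // joinEtotal ge_max lexx /=.
  by rewrite mleadM ?scaler_eq0 ?negb_or ?r0 // mleadZ // mleadXm mE.
rewrite lt_neqAle le_s andbT; apply: contraNneq s0 => E.
rewrite -mleadc_eq0 E mcoeffB -scalerAl mcoeffZ [_ * q]mulrC -{3}mE mcoeffMX.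
by rewrite divfK // subrr.
Qed.

(** Otherwise pick [p k] in [I k.+1] but not in [I k], with least leading monomial. Dickson's lemma
    gives [i < j] where the leading monomial of [p i] divides that of [p j]. Reducing [p j] by
    [p i], which already lies in [I j], gives 0 or an element of smaller leading monomial, which is
    in [I j] by minimality; so [p j] is in [I j] too. *)
Lemma mpoly_noetherian I : (forall k, is_ideal (I k)) ->
  (forall k p, I k p -> I k.+1 p) -> exists k, forall p, I k.+1 p -> I k p.
Proof.
move=> idI incI; apply: contrapT => H.
have incI' k l p : (k <= l)%N -> I k p -> I l p.
  elim: l => [|l IH]; first by rewrite leqn0 => /eqP->.
  by rewrite leq_eqVlt ltnS => /orP[/eqP<-//|] kl /(IH kl)/incI.
have ex k : exists p, (I k.+1 p /\ ~ I k p) /\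
    forall q, (mlead q < mlead p)%O -> I k.+1 q -> I k q.
  have [p [Ip nIp]] : exists p, I k.+1 p /\ ~ I k p.
    apply: contrapT => Hk; apply: H; exists k => p Ip.
    by apply: contrapT => nIp; apply: Hk; exists p.
  elim/(well_founded_ind (@ltom_wf n)): {p}(mlead p) {-2}p (erefl (mlead p)) Ip nIp.
  move=> m IH p pm Ip nIp.
  have [[q [[qp Iq] nIq]]|Hq] := EM (exists q, ((mlead q < mlead p)%O /\ I k.+1 q) /\ ~ I k q).
    by apply: (IH (mlead q) _ q) => //; rewrite -pm.
  exists p; split=> // q qp Iq; apply: contrapT => nIq; apply: Hq.
  by exists q.
have [p Hp] := choice ex.
have [i [j [ij le]]] := dickson (fun k => mlead (p k)).
have [[Ii nIi] _] := Hp i; have [[Ij nIj] minj] := Hp j.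
have n0 k : p k != 0.
  apply/eqP => pk0; have [[_ nIp] _] := Hp k.
  by apply: nIp; rewrite pk0; case: (idI k).
have [r /= Hr] := mlead_reduce (n0 j) (n0 i) le.
have Iji : I j (r * p i) by case: (idI j) => _ _; apply; apply: incI' Ii.
suff: I j (p j - r * p i).
  move=> h; apply: nIj; rewrite -[p j](subrK (r * p i)).
  by case: (idI j) => _ ID _; apply: ID.
case: Hr => [->|lt]; first by case: (idI j).
apply: minj => //; apply: idealB => //; exact: incI.
Qed.

(** The maximal condition, by dependent choice of an ascending chain. Indexing the ideals by [T]
    lets it select a vector with maximal annihilator. *)
Lemma ideal_family_maximal (T : Type) (F : T -> R -> Prop) (Q : T -> Prop) :
  (forall t, is_ideal (F t)) -> (exists t, Q t) ->
  exists2 t, Q t & forall u, Q u -> (forall p, F t p -> F u p) ->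
                     forall p, F u p -> F t p.
Proof.
move=> idF [t0 Qt0]; apply: contrapT => H.
have ex (t : {t | Q t}) : exists u : {t | Q t},
    (forall p, F (sval t) p -> F (sval u) p) /\
    ~ (forall p, F (sval u) p -> F (sval t) p).
  case: t => t Qt; apply: contrapT => Ht; apply: H; exists t => // u Qu tu.
  by apply: contrapT => nut; apply: Ht; exists (exist _ u Qu).
have [next Hnext] := choice ex.
pose t k := iter k next (exist _ t0 Qt0).
have [k Hk] := @mpoly_noetherian (fun k => F (sval (t k))) (fun k => idF _)
  (fun k => (Hnext (t k)).1).
exact: (Hnext (t k)).2.
Qed.

End Noetherian.

(** * Splitting off an isolated point of the support *)

(** Modulo [f] the element [p] is 1, and so are its powers. *)
Lemma bezout_expr (R : comNzRingType) (f r p : R) m : 1 = r * f + p ->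
  exists s, 1 = s * f + p ^+ m.
Proof.
move=> E; elim: m => [|m [s IH]]; first by exists 0; rewrite mul0r add0r.
exists (s * r * f + s * p + r * p ^+ m); rewrite exprS.
by rewrite -[LHS]mulr1 {1}IH E; ring.
Qed.

Section MaximalIdeal.
Variables (K : fieldType) (n : nat) (P : {mpoly K[n]} -> Prop).
Hypothesis maxP : is_maximal_ideal P.
Local Notation R := {mpoly K[n]}.
Implicit Types (p q a : R).

Lemma maximal_ideal_inv a : ~ P a -> exists r, P (1 - r * a).
Proof.
case: maxP => -[P0 PD PM] P1 Pmax nPa.
(* [J] is the ideal P + (a), which must contain 1 by maximality. *)
pose J q := exists r p, P p /\ q = p + r * a.
have idJ : is_ideal J.
  split=> [|_ _ [r [p [Pp ->]]] [s [q [Pq ->]]]|s _ [r [p [Pp ->]]]].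
  - by exists 0, 0; rewrite mul0r addr0.
  - by exists (r + s), (p + q); split; [exact: PD | ring].
  - by exists (s * r), (s * p); split; [exact: PM | ring].
have [p Pp|[r [p [Pp E]]]|H] := Pmax J idJ.
- by exists 0, p; rewrite mul0r addr0.
- by exists r; rewrite E addrK.
- by case: nPa; apply/H; exists 1, 0; rewrite mul1r add0r.
Qed.

Lemma maximal_ideal_prime : is_prime_ideal P.
Proof.
case: maxP => idP P1 _; split=> // p q Ppq.
have [Pp|nPp] := EM (P p); [by left | right].
have [r Pr] := maximal_ideal_inv nPp; case: idP => _ PD PM.
have -> : q = q * (1 - r * p) + r * (p * q) by ring.
by apply: PD; apply: PM.
Qed.

Lemma prime_ideal_expr p m : ~ P p -> ~ P (p ^+ m).
Proof.
case: maximal_ideal_prime => _ P1 Pp nPp.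
by elim: m => [|m IH] //; rewrite exprS => /Pp[].
Qed.

End MaximalIdeal.

Section IsolatedSupport.
Variables (K : fieldType) (n : nat) (V : lmodType {mpoly K[n]}).
Local Notation R := {mpoly K[n]}.
Variable P : R -> Prop.
Hypothesis maxP : is_maximal_ideal P.

(** These are the sections supported at the point [P] and the kernel of localization at [P],
    respectively. *)
Definition torsion (v : V) := forall p, P p -> exists m, p ^+ m *: v = 0.
Definition cotorsion (v : V) := exists2 f, ~ P f & f *: v = 0.

Lemma torsionD u v : torsion u -> torsion v -> torsion (u + v).
Proof.
move=> tu tv p Pp; have [a Ha] := tu p Pp; have [b Hb] := tv p Pp.
exists (a + b)%N; rewrite scalerDr {1}addnC !exprD -!scalerA Ha Hb.
by rewrite !scaler0 addr0.
Qed.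

Lemma torsionZ a v : torsion v -> torsion (a *: v).
Proof.
move=> tv p Pp; have [m Hm] := tv p Pp; exists m.
by rewrite scalerA mulrC -scalerA Hm scaler0.
Qed.

Lemma cotorsion0 : cotorsion 0.
Proof. by case: maxP => _ P1 _; exists 1; rewrite // scaler0. Qed.

Lemma cotorsionD u v : cotorsion u -> cotorsion v -> cotorsion (u + v).
Proof.
move=> [f nf fu] [g ng gv]; have [_ _ Pp] := maximal_ideal_prime maxP.
exists (f * g) => [/Pp[]//|].
by rewrite scalerDr {1}mulrC -!scalerA fu gv !scaler0 addr0.
Qed.

Lemma cotorsionZ a v : cotorsion v -> cotorsion (a *: v).
Proof.
by move=> [f nf fv]; exists f => //; rewrite scalerA mulrC -scalerA fv scaler0.
Qed.

(** If [r * f] is 1 modulo [P], then [1 - r * f] is nilpotent on [v], so [f] acts invertibly on [v]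
    while killing it. *)
Lemma torsion_cotorsion v : torsion v -> cotorsion v -> v = 0.
Proof.
move=> tv [f nPf fv]; have [r Pr] := maximal_ideal_inv maxP nPf.
have [m Hm] := tv _ Pr.
have [|s Hs] := @bezout_expr _ f r (1 - r * f) m; first by ring.
by rewrite -[v]scale1r Hs scalerDl -scalerA fv Hm scaler0 addr0.
Qed.

Lemma ann_ideal (v : V) : is_ideal (fun p : R => p *: v = 0).
Proof.
split=> [|p q pv qv|p q qv]; first by rewrite scale0r.
  by rewrite scalerDl pv qv addr0.
by rewrite -scalerA qv scaler0.
Qed.

Hypothesis isoP : forall (Q : R -> Prop) (u : V), is_prime_ideal Q ->
  (forall p, Q p <-> p *: u = 0) -> (forall p, Q p -> P p) ->
  forall p, P p -> Q p.

(* Otherwise a maximal annihilator avoiding the multiplicative set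
   {f p^m | f notin P} is an associated prime inside P not containing p. *)
Lemma locally_nilpotent_at p (w : V) : P p ->
  exists m, cotorsion (p ^+ m *: w).
Proof.
move=> Pp; apply: contrapT => H.
pose avoid (u : V) := forall m, ~ cotorsion (p ^+ m *: u).
have [|u Av umax] := ideal_family_maximal ann_ideal (Q := avoid).
  by exists w => m Hm; apply: H; exists m.
have avoidZ f m : ~ P f -> avoid ((f * p ^+ m) *: u).
  move=> nPf k [g nPg]; rewrite !scalerA => E; apply: (Av (k + m)%N).
  have [_ _ Pprime] := maximal_ideal_prime maxP.
  exists (g * f) => [/Pprime[]//|].
  by rewrite scalerA -E; congr (_ *: _); rewrite exprD; ring.
have nPm m f : ~ P f -> (f * p ^+ m) *: u <> 0.
  by move=> nPf E; apply: (Av m); exists f; rewrite // scalerA.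
have [idP P1 _] := maxP.
have primeQ : is_prime_ideal (fun q : R => q *: u = 0).
  split; first exact: ann_ideal.
    by move=> E; apply: (nPm 0%N 1); rewrite // expr0 mulr1.
  move=> a b abu.
  (* If some [g] outside [P] kills [p ^+ m * a *: u], then [a] kills [(g * p ^+ m) *: u], which
     still avoids; otherwise [a *: u] avoids and [b] kills it. In both cases maximality of the
     annihilator of [u] brings the killer back into it. *)
  have [[m [g nPg]]|Aau] := EM (exists m, cotorsion (p ^+ m *: (a *: u))).
    move=> E; left; apply: (umax ((g * p ^+ m) *: u)); first exact: avoidZ.
      by move=> q qu; rewrite scalerA mulrC -scalerA qu scaler0.
    by rewrite -E !scalerA; congr (_ *: _); ring.
  right; apply: (umax (a *: u)).
  - by move=> m Hm; apply: Aau; exists m.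
  - by move=> q qu; rewrite scalerA mulrC -scalerA qu scaler0.
  - by rewrite scalerA mulrC.
have pu : p *: u = 0.
  apply: (isoP (u := u) primeQ) => // q qu; apply: contrapT => nPq.
  by apply: (nPm 0%N q); rewrite // expr0 mulr1.
by apply: (nPm 1%N 1) => //; rewrite mul1r.
Qed.

(** Noetherian induction on the annihilator of [w]. If [w] is not torsion, some [f] outside [P]
    kills [p ^+ m *: w] but [p ^+ m] does not kill [w], so [f *: w] has a larger annihilator and
    splits. As [f] is invertible modulo [P], [w] is a multiple of [f *: w] plus a cotorsion
    element. *)
Lemma torsion_split (w : V) : exists a b, [/\ torsion a, cotorsion b & w = a + b].
Proof.
pose split (w : V) := exists a b, [/\ torsion a, cotorsion b & w = a + b].
have splitD u v : split u -> split v -> split (u + v).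
  move=> [a [b [ta cb ->]]] [c [d [tc cd ->]]].
  exists (a + c), (b + d); split; [exact: torsionD|exact: cotorsionD|].
  by rewrite addrACA.
have splitZ r u : split u -> split (r *: u).
  move=> [a [b [ta cb ->]]]; exists (r *: a), (r *: b).
  by split; [exact: torsionZ|exact: cotorsionZ|rewrite scalerDr].
have splitC u : cotorsion u -> split u.
  move=> cu; exists 0, u; split; rewrite ?add0r // => p _.
  by exists 0%N; rewrite scaler0.
apply: contrapT => nw.
have [|{nw}w nw wmax] := ideal_family_maximal ann_ideal (Q := fun u => ~ split u).
  by exists w.
apply: nw; have [tw|/existsNP[p /not_implyP[Pp Hp]]] := EM (torsion w).
  by exists w, 0; split; rewrite ?addr0 //; exact: cotorsion0.
have [m [f nPf fpw]] := locally_nilpotent_at w Pp.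
have sfw : split (f *: w).
  apply: contrapT => nfw; apply: Hp; exists m; apply: (wmax (f *: w)) => //.
    by move=> q qw; rewrite scalerA mulrC -scalerA qw scaler0.
  by rewrite -fpw !scalerA mulrC.
have [r Pr] := maximal_ideal_inv maxP nPf.
have [k ck] := locally_nilpotent_at w Pr.
have [|s Hs] := @bezout_expr _ f r (1 - r * f) k; first by ring.
rewrite -[w]scale1r Hs scalerDl -scalerA.
by apply: splitD; [exact: splitZ | exact: splitC].
Qed.

End IsolatedSupport.

(** * Zariski's lemma *)

Lemma residue_field (K : fieldType) (n : nat) (P : {mpoly K[n]} -> Prop) :
  is_maximal_ideal P ->
  exists (L : fieldType) (pi : {rmorphism {mpoly K[n]} -> L}),
    (forall y, exists x, pi x = y) /\ (forall p, pi p = 0 <-> P p).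
Proof.
move=> maxP; have [[P0 PD PM] P1 _] := maxP.
pose S : {pred {mpoly K[n]}} := fun p => `[< P p >].
have SE p : (p \in S) = `[< P p >] by [].
have clS : idealr_closed S.
  split=> [||a u v]; rewrite ?SE; [exact/asboolP|exact/asboolPn|].
  by move=> /asboolP Pu /asboolP Pv; apply/asboolP/PD => //; apply: PM.
pose I : idealr {mpoly K[n]} := HB.pack S (isIdealr.Build _ S clS).
pose Q := {ideal_quot I}.
pose pi : {rmorphism {mpoly K[n]} -> Q} := \pi_Q%qT.
have piP x : pi x = 0 <-> P x.
  rewrite -(rmorph0 pi); split=> [/eqmodP|Px].
    by rewrite /= /Quotient.equiv subr0 => /asboolP.
  by apply/eqmodP; rewrite /= /Quotient.equiv subr0; apply/asboolP.
have pi_surj (y : Q) : exists x, pi x = y by exists (repr y); rewrite /pi /= reprK.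
(* The field structure wants a total inverse, so the value at 0 is fixed to be 0. *)
have inv_ex (y : Q) : exists z : Q, (y != 0 -> z * y = 1) /\ (y = 0 -> z = 0).
  have [->|y0] := eqVneq y 0; first by exists 0.
  have [x xy] := pi_surj y; have [|r Pr] := @maximal_ideal_inv _ _ _ maxP x.
    by move=> /piP x0; move: y0; rewrite -xy x0 eqxx.
  exists (pi r); split=> [_|y00]; last by rewrite y00 eqxx in y0.
  by apply/esym/subr0_eq; rewrite -xy -rmorphM -(rmorph1 pi) -rmorphB; apply/piP.
have [inv Hinv] := choice inv_ex.
pose L : fieldType := HB.pack Q (GRing.ComNzRing_isField.Build Q
  (fun y => (Hinv y).1) ((Hinv 0).2 erefl)).
by exists L, pi.
Qed.

(** * Goldman domains inside a field *)

Section GoldmanDomains.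
Variable L : fieldType.
Implicit Types (A : comNzRingType).

(* Localizing the subring [phi A] of [L] at one element gives a field. *)
Definition goldman A (phi : {rmorphism A -> L}) :=
  exists2 s, phi s != 0 &
    forall z, phi z != 0 -> exists y m, phi y * phi z = phi s ^+ m.

(** The subring phi(A)[b] of [L] is represented by the evaluation map from [{poly A}], so that
    adjunctions can be iterated without forming subrings. *)
Definition adjoin A (phi : {rmorphism A -> L}) (b : L) : {rmorphism {poly A} -> L} :=
  horner_morph (fun a => mulrC b (phi a)).

Lemma adjoinE A (phi : {rmorphism A -> L}) b p :
  adjoin phi b p = (map_poly phi p).[b].
Proof. by []. Qed.

Lemma adjoinC A (phi : {rmorphism A -> L}) b a : adjoin phi b a%:P = phi a.
Proof. exact: horner_morphC. Qed.

Lemma adjoinX A (phi : {rmorphism A -> L}) b : adjoin phi b 'X = b.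
Proof. exact: horner_morphX. Qed.

(* If [b] were transcendental, [1 + X s] would divide a power of [s]. *)
Lemma goldman_algebraic A (phi : {rmorphism A -> L}) b :
  goldman (adjoin phi b) ->
  exists2 p, map_poly phi p != 0 & adjoin phi b p = 0.
Proof.
move=> [s s0 Hs]; apply: contrapT => H.
have inj p : adjoin phi b p = 0 -> map_poly phi p = 0.
  by move=> p0; apply: contrapT => /eqP np; apply: H; exists p.
pose z := 1 + 'X * s; have zE : map_poly phi z = 1 + 'X * map_poly phi s.
  by rewrite rmorphD rmorph1 rmorphM /= map_polyX.
have z0 : adjoin phi b z != 0.
  apply/eqP => /inj /(congr1 (fun p => p.[0])) /eqP.
  by rewrite zE hornerD hornerM hornerX mul0r hornerC horner0 addr0 oner_eq0.
have [y [m E]] := Hs z z0.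
have /eqP : map_poly phi (y * z - s ^+ m) = 0.
  by apply: inj; rewrite rmorphB rmorphM rmorphXn E subrr.
rewrite rmorphB rmorphM rmorphXn /= zE subr_eq0 => /eqP {}E.
set u := map_poly phi s in E; have u0 : u != 0.
  by apply: contraNneq s0 => u0; rewrite adjoinE -/u u0 horner0.
(* [1 + 'X * u] is coprime to [u] yet divides [u ^+ m], so it is coprime to itself; this contradicts
   its positive degree. *)
have cop : coprimep (1 + 'X * u) (u ^+ m).
  by apply: coprimep_expr; rewrite coprimep_sym addrC coprimep_addl_mul coprimep1.
have : coprimep (1 + 'X * u) (1 + 'X * u).
  by apply: coprimep_dvdl cop; rewrite -E dvdp_mulIr.
rewrite coprimepp addrC size_polyDl ?size_polyC ?oner_eq0 /= mulrC size_mulX //.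
  by rewrite eqSS size_poly_eq0 (negPf u0).
by rewrite ltnS size_poly_gt0.
Qed.

Lemma adjoin_inv_fraction A (phi : {rmorphism A -> L}) t d : phi t != 0 ->
  exists c m, phi t ^+ m * adjoin phi (phi t)^-1 d = phi c.
Proof.
move=> t0; elim/poly_ind: d => [|d a [c [m E]]].
  by exists 0, 0%N; rewrite !rmorph0 mulr0.
exists (c + t ^+ m.+1 * a), m.+1.
rewrite [adjoin _ _ _]rmorphD [adjoin _ _ (_ * _)]rmorphM adjoinX adjoinC.
rewrite [RHS]rmorphD rmorphM -E rmorphXn.
by rewrite exprS; field.
Qed.

(** Multiplying a monic equation of degree [d] for the inverse by [psi z ^+ d] exhibits 1 as [psi z]
    times a value of [psi]. *)
Lemma integral_inv_mem A (psi : {rmorphism A -> L}) (z : A) : psi z != 0 ->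
  integralOver psi (psi z)^-1 -> exists e, psi z * psi e = 1.
Proof.
move=> z0 [q /(monic_map psi) mq /rootP].
have := monic_neq0 mq; rewrite -size_poly_gt0; move: mq; rewrite monicE lead_coefE.
rewrite horner_coef; case: (size _) => // d /eqP /= lq _.
rewrite big_ord_recr /= lq mul1r => /eqP; rewrite addr_eq0 => /eqP E.
exists (- \sum_(i < d) q`_i * z ^+ (d - i.+1)).
have /(congr1 (fun x => - x * psi z ^+ d)) := E.
rewrite opprK -exprMn mulVf // expr1n => <-.
rewrite rmorphN mulrN !rmorph_sum mulNr; congr (- _).
rewrite mulr_sumr mulr_suml; apply: eq_bigr => i _ /=.
rewrite rmorphM rmorphXn coef_map /= mulrCA -mulrA; congr (_ * _).
rewrite -exprS subnSK // exprVn; move: (nat_of_ord i) (ltnW (ltn_ord i)) => k kd.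
rewrite -{2}(subnKC kd) exprD.
by rewrite mulKf // expf_neq0.
Qed.

Section Integrality.
Variables (A B : comNzRingType) (phi : {rmorphism A -> L}) (psi : {rmorphism B -> L}).
Hypothesis integral_phi : forall a, integralOver psi (phi a).

Lemma integral_expr x m : integralOver psi x -> integralOver psi (x ^+ m).
Proof.
by move=> ix; elim: m => [|m IH]; [exact: integral1 | rewrite exprS; exact: integral_mul].
Qed.

Lemma integral_adjoin b p : integralOver psi b -> integralOver psi (adjoin phi b p).
Proof.
move=> ib; rewrite adjoinE; apply: integral_horner => //.
by apply/integral_poly => i; rewrite coef_map; apply: integral_phi.
Qed.

Lemma algebraic_integral b p : adjoin phi b p = 0 -> map_poly phi p != 0 ->
  integralOver psi (lead_coef (map_poly phi p))^-1 -> integralOver psi b.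
Proof.
move=> pb p0 ilc; set P := map_poly phi p in p0 ilc.
have lc0 : lead_coef P != 0 by rewrite lead_coef_eq0.
apply: (@integral_root_monic _ _ _ b ((lead_coef P)^-1 *: P)).
- by rewrite monicE lead_coefZ mulVf.
- by apply/rootP; rewrite hornerZ -adjoinE pb mulr0.
by apply/integral_poly => i; rewrite coefZ coef_map; apply: integral_mul => //; apply: integral_phi.
Qed.

End Integrality.

(** Since [x] is nonzero, factors ['X] can be cancelled until the constant term survives. *)
Lemma root_nonzero_constant_term A (phi : {rmorphism A -> L}) x p :
  x != 0 -> map_poly phi p != 0 -> adjoin phi x p = 0 ->
  exists q c, phi c != 0 /\ adjoin phi x q * x + phi c = 0.
Proof.
move=> x0; elim/poly_ind: p => [|p c IH]; first by rewrite rmorph0 eqxx.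
rewrite [adjoin _ _ _]rmorphD [adjoin _ _ _]rmorphM adjoinX adjoinC.
have [c0|c0] := eqVneq (phi c) 0; last by move=> _ E; exists p, c.
rewrite c0 addr0 rmorphD rmorphM /= map_polyX map_polyC /= c0 addr0.
move=> p0 /eqP; rewrite mulf_eq0 (negPf x0) orbF => /eqP px.
by apply: IH => //; apply: contraNneq p0 => ->; rewrite mul0r.
Qed.

(** Let [alpha] be the leading coefficient of an equation for [b]. Then [b], and with it the image
    of [s], is integral over phi(A)[1/alpha]. Inverting also the nonzero constant term of an
    equation for [s] makes the inverse of [s] integral. Inverses of nonzero [phi z], being of the
    form y / s^k, are then integral over phi(A)[1/t] with t the image of [alpha * gamma], hence
    belong to it, and a power of t clears denominators. *)
Lemma goldman_descent A (phi : {rmorphism A -> L}) b :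
  goldman (adjoin phi b) -> goldman phi.
Proof.
move=> gb; have [p p0 pb] := goldman_algebraic gb; have [s s0 Hs] := gb.
pose alpha := p`_(size (map_poly phi p)).-1.
have lcE : lead_coef (map_poly phi p) = phi alpha by rewrite lead_coefE coef_map.
have alpha0 : phi alpha != 0 by rewrite -lcE lead_coef_eq0.
pose psi1 := adjoin phi (phi alpha)^-1.
have iphi1 a : integralOver psi1 (phi a).
  by rewrite -(adjoinC phi (phi alpha)^-1); apply: integral_id.
have ib1 : integralOver psi1 b.
  apply: algebraic_integral pb p0 _ => //.
  by rewrite lcE -(adjoinX phi (phi alpha)^-1); apply: integral_id.
have [q mq /rootP qs] := integral_adjoin iphi1 s ib1.
have [|r [c [c0 Er]]] := root_nonzero_constant_term s0 _ qs.
  by rewrite monic_neq0 // monic_map.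
(* [gamma] is a numerator in [A] of the constant term [c], so inverting [alpha * gamma] inverts both
   [alpha] and that term. *)
have [gamma [m Egamma]] := adjoin_inv_fraction c alpha0.
have gamma0 : phi gamma != 0 by rewrite -Egamma mulf_neq0 ?expf_neq0.
have t0 : phi (alpha * gamma) != 0 by rewrite rmorphM mulf_neq0.
pose psi := adjoin phi (phi (alpha * gamma))^-1.
have iphi a : integralOver psi (phi a).
  by rewrite -(adjoinC phi (phi (alpha * gamma))^-1); apply: integral_id.
have it : integralOver psi (phi (alpha * gamma))^-1.
  by rewrite -(adjoinX phi (phi (alpha * gamma))^-1); apply: integral_id.
have ialpha : integralOver psi (phi alpha)^-1.
  have -> : (phi alpha)^-1 = (phi (alpha * gamma))^-1 * phi gamma.
    by rewrite rmorphM invfM -mulrA mulVf // mulr1.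
  exact: integral_mul.
have igamma : integralOver psi (phi gamma)^-1.
  have -> : (phi gamma)^-1 = (phi (alpha * gamma))^-1 * phi alpha.
    by rewrite rmorphM mulrC invfM mulVKf.
  exact: integral_mul.
have ib : integralOver psi b.
  by apply: algebraic_integral pb p0 _ => //; rewrite lcE.
have ipsi1 d : integralOver psi (psi1 d) by apply: integral_adjoin.
have is' : integralOver psi (adjoin phi b s) by apply: integral_adjoin.
have isV : integralOver psi (adjoin phi b s)^-1.
  have -> : (adjoin phi b s)^-1 =
      - (adjoin psi1 (adjoin phi b s) r * (phi (alpha ^+ m) * (phi gamma)^-1)).
    apply: (mulIf s0); rewrite mulVf // rmorphXn.
    move/eqP: Er; rewrite addr_eq0 => /eqP Er.
    rewrite mulNr mulrAC Er mulNr opprK mulrCA mulrA Egamma.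
    by rewrite divff.
  by apply/integral_opp/integral_mul; [exact: integral_adjoin | exact: integral_mul].
exists (alpha * gamma) => // z z0.
have [|y [k E]] := Hs z%:P; first by rewrite adjoinC.
have izV : integralOver psi (psi z%:P)^-1.
  have -> : (psi z%:P)^-1 = adjoin phi b y * (adjoin phi b s)^-1 ^+ k.
    rewrite exprVn -E !adjoinC invfM mulrA mulfV ?mul1r //.
    by have := expf_neq0 k s0; rewrite -E mulf_eq0 negb_or => /andP[].
  by apply: integral_mul; [exact: integral_adjoin | exact: integral_expr].
have [|e Ee] := integral_inv_mem _ izV; first by rewrite adjoinC.
have [d [l Ed]] := adjoin_inv_fraction e t0.
exists d, l; rewrite -Ed -mulrA -[RHS]mulr1 -Ee /psi adjoinC.
by congr (_ * _); apply: mulrC.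
Qed.

(** The premise says that [L] is generated as a ring by the image of [phi] and [bs]. Descent removes
    one generator at a time; with none left [phi] is onto, and [s = 1] works. *)
Lemma finitely_generated_goldman (bs : seq L) A (phi : {rmorphism A -> L}) :
  (forall S : L -> Prop, (forall a, S (phi a)) -> (forall b, b \in bs -> S b) ->
     (forall x y, S x -> S y -> S (x + y)) ->
     (forall x y, S x -> S y -> S (x * y)) -> forall z, S z) ->
  goldman phi.
Proof.
elim: bs A phi => [|b bs IH] A phi H.
  exists 1 => [|z z0]; first by rewrite rmorph1 oner_eq0.
  have [a|//|_ _ [x ->] [y ->]|_ _ [x ->] [y ->]|y Ey] :=
    H (fun x => exists a, x = phi a) _ _ _ _ (phi z)^-1.
  - by exists a.
  - by exists (x + y); rewrite rmorphD.
  - by exists (x * y); rewrite rmorphM.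
  - by exists y, 0%N; rewrite -Ey mulVf // expr0.
apply: (@goldman_descent _ _ b); apply: IH => S Sphi Sbs SD SM.
apply: H => // [a|c]; first by rewrite -(adjoinC phi b).
by rewrite inE => /orP[/eqP->|/Sbs//]; rewrite -(adjoinX phi b).
Qed.
End GoldmanDomains.

(** The residue field is finitely generated over the subring K[x], x being the image of ['X_i]; so
    K[x] is a Goldman domain and x is algebraic over [K]. *)
Lemma maximal_ideal_algebraic (K : fieldType) (n : nat) (P : {mpoly K[n]} -> Prop) i :
  is_maximal_ideal P ->
  exists2 p : {poly K}, p != 0 & P (map_poly (@mpolyC n K) p).['X_i].
Proof.
move=> /residue_field [L [pi [pi_surj piP]]].
pose phi : {rmorphism K -> L} := pi \o @mpolyC n K.
have [|p p0 Ep] := @goldman_algebraic L _ phi (pi 'X_i).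
  apply: (finitely_generated_goldman (bs := [seq pi 'X_j | j : 'I_n])).
  move=> S SC SX SD SM z; have [x <-] := pi_surj z.
  have Sphi a : S (phi a) by rewrite -(adjoinC phi (pi 'X_i)).
  have SX1 j : S (pi 'X_j) by apply/SX/map_f/mem_enum.
  have SXm m : S (pi 'X_[m]).
    rewrite mpolyXE_id rmorph_prod; apply: big_ind => // [|j _].
      by rewrite -(rmorph1 phi).
    rewrite rmorphXn; elim: (m j) => [|k IH]; first by rewrite expr0 -(rmorph1 phi).
    by rewrite exprS; apply: SM.
  elim/mpolyind: x => [|c m p _ _ IH]; first by rewrite rmorph0 -(rmorph0 phi).
  rewrite rmorphD; apply: SD => //; rewrite -mul_mpolyC rmorphM.
  by apply: SM => //; apply: (Sphi c).
exists p; first by apply: contraNneq p0 => ->; rewrite rmorph0.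
apply/piP; rewrite -Ep adjoinE /phi map_poly_comp horner_map.
by [].
Qed.

(** * Kashiwara's decomposition *)

Lemma mderiv_expr (K : fieldType) (n : nat) (p : {mpoly K[n]}) i m :
  (p ^+ m.+1)^`M(i) = (p ^+ m * p^`M(i)) *+ m.+1.
Proof.
elim: m => [|m IH]; first by rewrite expr1 expr0 mul1r.
rewrite exprS mderivM IH -mulrnAr mulrA -exprS mulrC [in RHS]mulrS.
by rewrite mulrnAr.
Qed.

Section KashiwaraDescent.
Variables (K : fieldType) (n : nat) (V : lmodType {mpoly K[n]}).
Variable d : 'I_n -> {additive V -> V}.
Local Notation R := {mpoly K[n]}.
Hypothesis char0 : [pchar K] =i pred0.
Hypothesis d_comm : forall i j v, d i (d j v) = d j (d i v).
Hypothesis d_leibniz : forall i (p : R) v, d i (p *: v) = p *: d i v + p^`M(i) *: v.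

Lemma torsionfree_mulrn (v : V) m : v *+ m.+1 = 0 -> v = 0.
Proof.
move=> E; have m0 : m.+1%:R != 0 :> K by rewrite (pcharf0P K).1.
have -> : v = (m.+1%:R^-1)%:MP *: (v *+ m.+1).
  by rewrite -scaler_nat scalerA -(rmorph_nat (@mpolyC n K)) -mpolyCM mulVf // scale1r.
by rewrite E scaler0.
Qed.

Section OneVariable.
Variables (i : 'I_n) (G u h : R).
Hypothesis bezout : u * G + h * G^`M(i) = 1.

Lemma kernel_deriv_injective m w : G *: d i w = 0 -> G ^+ m *: w = 0 -> w = 0.
Proof.
move=> Gdw; elim: m => [|m IH]; first by rewrite scale1r.
move=> E; apply: IH; move: (congr1 (d i) E).
rewrite raddf0 d_leibniz exprSr -scalerA Gdw scaler0 add0r -exprSr mderiv_expr.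
rewrite -scalerMnl => /torsionfree_mulrn E2.
rewrite -[G ^+ m]mulr1 -bezout.
have -> : G ^+ m * (u * G + h * G^`M(i)) = u * G ^+ m.+1 + h * (G ^+ m * G^`M(i)).
  by rewrite exprS; ring.
by rewrite scalerDl -scalerA E -scalerA E2 !scaler0 addr0.
Qed.

Variable N : V -> Prop.
Hypothesis ND : forall v w, N v -> N w -> N (v + w).
Hypothesis NZ : forall (p : R) v, N v -> N (p *: v).
Hypothesis Nd : forall v, N v -> N (d i v).

Lemma kernel_deriv_decomposition m w : N w -> G ^+ m *: w = 0 ->
  exists a b, [/\ N a, N b, G *: a = 0 & w = a + d i b].
Proof.
have N0 v : N v -> N 0 by move=> Nv; rewrite -(scale0r v); apply: NZ.
elim: m w => [|[|m] IH] w Nw E.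
- by exists 0, 0; rewrite raddf0 scaler0 addr0; split; rewrite -?E ?scale1r //; apply: NZ.
- by exists w, 0; rewrite raddf0 addr0 -{2}E expr1; split=> //; apply: N0 Nw.
pose b := (- (m.+1%:R^-1)%:MP * (h * G)) *: w.
have Nb : N b by apply: NZ.
have [||a [b' [Na Nb' Ga Ew]]] := IH (w - d i b).
- by apply: ND => //; rewrite -scaleN1r; apply/NZ/Nd.
- have Gb : G ^+ m.+1 *: b = 0.
    rewrite scalerA (_ : G ^+ _ * _ = (- (m.+1%:R^-1)%:MP * h) * G ^+ m.+2); last first.
      by rewrite !exprS; ring.
    by rewrite -scalerA E scaler0.
  have /eqP := congr1 (d i) Gb; rewrite raddf0 d_leibniz addr_eq0 => /eqP Edb.
  rewrite scalerBr Edb mderiv_expr scalerA opprK.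
  have m0 : m.+1%:R != 0 :> K by rewrite (pcharf0P K).1.
  have mm : m.+1%:R * (m.+1%:R^-1)%:MP = 1 :> R.
    by rewrite -(rmorph_nat (@mpolyC n K)) -mpolyCM mulfV.
  have -> : (G ^+ m * G^`M(i)) *+ m.+1 * (- (m.+1%:R^-1)%:MP * (h * G)) =
      (m.+1%:R * (m.+1%:R^-1)%:MP) * (- (h * G^`M(i)) * G ^+ m.+1).
    rewrite -mulr_natl exprS; move: _%:MP _%:R (_ ^`M(_)) => c k G'; ring.
  rewrite mm mul1r -scalerDl.
  have -> : G ^+ m.+1 + - (h * G^`M(i)) * G ^+ m.+1 = u * G ^+ m.+2.
    by rewrite [G ^+ m.+2]exprS -[X in X + _ = _]mul1r -bezout; ring.
  by rewrite -scalerA E scaler0.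
exists a, (b + b'); split=> //; first exact: ND.
by rewrite raddfD addrCA -Ew addrC subrK.
Qed.

End OneVariable.

Variable G : 'I_n -> R.
Hypothesis G_bezout : forall i, exists u h, u * G i + h * (G i)^`M(i) = 1.
Hypothesis G_const : forall i j, i != j -> (G i)^`M(j) = 0.

(** [N] is arbitrary so that the induction can replace it by its intersection with the kernel of
    [G i]. This stays stable under the remaining derivations because [G i] is constant for them. *)
Lemma common_kernel_no_deriv (s : seq 'I_n) (N : V -> Prop) v w :
  uniq s ->
  N 0 -> (forall v w, N v -> N w -> N (v + w)) ->
  (forall (p : R) v, N v -> N (p *: v)) ->
  (forall i v, i \in s -> N v -> N (d i v)) ->
  (forall i v, i \in s -> N v -> exists m, G i ^+ m *: v = 0) ->
  N v -> (forall i, i \in s -> G i *: v = 0) -> (forall i, N (w i)) ->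
  v = \sum_(i <- s) d i (w i) -> v = 0.
Proof.
elim: s N w => [|i s IH] N w; first by rewrite big_nil.
move=> /= /andP[nis us] N0 ND NZ Nd Nnil Nv Gv Nw E.
have is_ : i \in i :: s by rewrite mem_head.
have ss j : j \in s -> j \in i :: s by rewrite inE orbC => ->.
have ij j : j \in s -> i != j by apply: contraTneq => <-.
have [u [h bez]] := G_bezout i.
have dec j : exists ab : V * V, [/\ N ab.1, N ab.2, G i *: ab.1 = 0 & w j = ab.1 + d i ab.2].
  have [m Hm] := Nnil _ _ is_ (Nw j).
  have Ndi u' : N u' -> N (d i u') by apply: Nd.
  have [a [b H]] := kernel_deriv_decomposition bez ND NZ Ndi (Nw j) Hm.
  by exists (a, b).
have [ab Hab] := choice dec.
pose a j := (ab j).1; pose b j := (ab j).2.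
have Nsum (r : seq 'I_n) (F : 'I_n -> V) : (forall j, j \in r -> N (F j)) ->
    N (\sum_(j <- r) F j).
  by move=> NF; rewrite big_seq; apply: big_ind.
(* Writing [w j = a j + d i (b j)] and commuting derivations collects everything in the image of
   [d i] into [d i x]. Since [G i] kills [v] and each [d j (a j)], it kills [d i x], which forces
   [x = 0]. *)
pose x := w i + \sum_(j <- s) d j (b j).
have Ev : v = \sum_(j <- s) d j (a j) + d i x.
  rewrite E big_cons /x raddfD addrCA; congr (_ + _).
  rewrite raddf_sum -big_split /=; apply: eq_bigr => j _.
  by have [_ _ _ ->] := Hab j; rewrite raddfD d_comm.
have Nx : N x.
  by apply: ND => //; apply: Nsum => j js; apply: Nd (ss _ js) _; case: (Hab j).
have Gda j : j \in s -> G i *: d j (a j) = 0.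
  move=> js; have [_ _ Ga _] := Hab j; move: (congr1 (d j) Ga).
  by rewrite d_leibniz raddf0 G_const ?ij // scale0r addr0.
have x0 : x = 0.
  have [m Hm] := Nnil _ _ is_ Nx; apply: (kernel_deriv_injective bez _ Hm).
  have /(congr1 (fun v => G i *: v)) := Ev.
  by rewrite Gv // scalerDr scaler_sumr (eq_big_seq (fun=> 0) Gda) big1 // add0r => <-.
apply: (IH (fun v => N v /\ G i *: v = 0) a) => //.
- by rewrite scaler0.
- by move=> y z [Ny Gy] [Nz Gz]; rewrite scalerDr Gy Gz addr0; split; [exact: ND|].
- move=> p y [Ny Gy]; rewrite scalerA mulrC -scalerA Gy scaler0.
  by split; [exact: NZ|].
- move=> j y js [Ny Gy]; split; first by apply: Nd => //; apply: ss.
  move: (congr1 (d j) Gy).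
  by rewrite d_leibniz raddf0 G_const ?ij // scale0r addr0.
- by move=> j y js [Ny _]; apply: Nnil (ss _ js) Ny.
- by split; [|exact: Gv].
- by move=> j js; apply: Gv; apply: ss.
- by move=> j; case: (Hab j).
- by rewrite {1}Ev x0 raddf0 addr0.
Qed.
End KashiwaraDescent.

(** * The module over the polynomial ring *)

Lemma submm n (m : 'X_{1..n}) : (m - m)%MM = 0%MM.
Proof. by rewrite -{1}[m]add0m addmK. Qed.

(** * Separable one-variable elements of a maximal ideal *)

Section Separability.
Variables (K : fieldType) (n : nat) (i : 'I_n).
Hypothesis char0 : [pchar K] =i pred0.
Local Notation R := {mpoly K[n]}.

Definition univariate : {rmorphism {poly K} -> R} :=
  horner_morph (fun a => mulrC 'X_i (mpolyC n a)).

Lemma mderiv_univariate j p :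
  (univariate p)^`M(j) = if j == i then univariate p^`() else 0.
Proof.
have uX : univariate 'X = 'X_i by apply: horner_morphX.
have uC c : univariate c%:P = c%:MP by apply: horner_morphC.
elim/poly_ind: p => [|p c IH]; first by rewrite deriv0 !rmorph0 mderiv0 if_same.
rewrite derivD derivM derivX derivC addr0 mulr1.
rewrite [univariate (_ + c%:P)]rmorphD [univariate (_ * 'X)]rmorphM uX uC.
rewrite mderivD mderivC addr0 mderivM IH mderivX mnm1E [i == j]eq_sym.
case: eqVneq => [->|_]; last by rewrite mul0r scale0r mulr0 addr0.
by rewrite scale1r submm mpolyX0 mulr1 rmorphD rmorphM /= uX.
Qed.

(** Take [g] of least degree and let d be its gcd with the derivative. If d were in [P], so would be
    the derivative, nonzero in characteristic zero and of smaller degree. So [P] contains the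
    cofactor of d in [g], and minimality makes d constant. *)
Lemma separable_univariate (P : R -> Prop) : is_maximal_ideal P ->
  exists G, [/\ P G, exists u h, u * G + h * G^`M(i) = 1 &
    forall j, i != j -> G^`M(j) = 0].
Proof.
move=> maxP; have [[P0 PD PM] P1 _] := maxP.
have [_ _ Pprime] := maximal_ideal_prime maxP.
have [|g [g0 Pg] gmin] := @exists_minimal {poly K}
    (fun p => p != 0 /\ P (univariate p)) (fun p : {poly K} => size p).
  by have [p p0 Pp] := maximal_ideal_algebraic i maxP; exists p.
have deriv_notin (q : {poly K}) : (size q < size g)%N -> q != 0 -> ~ P (univariate q).
  by move=> lt q0 Pq; move: lt; rewrite ltnNge gmin.
have cop : coprimep g g^`().
  have g_gt1 : (1 < size g)%N.
    rewrite ltnNge; apply/negP => /size1_polyC gC; apply: P1.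
    have c0 : g`_0 != 0 by apply: contraNneq g0 => c0; rewrite gC c0.
    rewrite -mpolyC1 -(mulVf c0) mpolyCM; apply: PM.
    by rewrite -(horner_morphC (fun a => mulrC 'X_i (mpolyC n a))) -gC.
  have g'0 : g^`() != 0.
    apply/eqP => /(congr1 (fun q : {poly K} => q`_(size g).-2)) /eqP.
    rewrite coef_deriv coef0 -mulr_natr mulf_eq0 (pcharf0P K).1 // orbF.
    have := lead_coef_eq0 g; rewrite lead_coefE (negPf g0).
    by case: (size g) g_gt1 => [|[|m]] //= _ ->.
  have [e ge] := dvdpP _ _ (dvdp_gcdl g g^`()).
  have [f gf] := dvdpP _ _ (dvdp_gcdr g g^`()).
  have d0 : gcdp g g^`() != 0 by rewrite gcdp_eq0 negb_and g0.
  rewrite /coprimep; move: (gcdp _ _) d0 ge gf => d d0 ge gf.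
  have e0 : e != 0 by apply: contraNneq g0 => e0; rewrite ge e0 mul0r.
  have : P (univariate e * univariate d) by rewrite -rmorphM -ge.
  case/Pprime => [Pe|Pd].
    have := gmin e (conj e0 Pe); rewrite {1}ge size_mul //.
    rewrite -size_poly_gt0 in d0; rewrite -size_poly_gt0 in e0.
    by move: d0 e0; case: (size d) (size e) => [|[|m]] [|l] //; lia.
  case: (@deriv_notin g^`()) => //; first exact: lt_size_deriv.
  by rewrite gf rmorphM; apply: PM.
have /Bezout_eq1_coprimepP[[u h] /= E] := cop.
exists (univariate g); split=> //.
  exists (univariate u), (univariate h).
  by rewrite mderiv_univariate eqxx -!rmorphM -rmorphD E rmorph1.
by move=> j; rewrite eq_sym mderiv_univariate => /negPf ->.
Qed.
End Separability.

Section PolynomialModule.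
Variables (K : fieldType) (n : nat) (M : lmodType K).
Variables (xop dop : 'I_n -> {linear M -> M}).
Local Notation R := {mpoly K[n]}.

(** The set of [p] with this commutation rule is closed under products, so the Weyl relations for
    single variables extend to monomials, then linearly. *)
Lemma dop_ract (hW : weyl_module_rel xop dop) i p v :
  dop i (ract xop p v) = ract xop p (dop i v) + ract xop p^`M(i) v.
Proof.
pose T p := forall v, dop i (ract xop p v) = ract xop p (dop i v) + ract xop p^`M(i) v.
have T1 : T 1 by move=> u; rewrite -mpolyC1 mderivC ract0 !ractC !scale1r addr0.
have TM q r : T q -> T r -> T (q * r).
  move=> Tq Tr u; rewrite mderivM ractD !(ractM hW) Tq Tr linearD /=.
  by rewrite -addrA; congr (_ + _); rewrite addrC.
have TX m : T 'X_[m].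
  rewrite mpolyXE_id; apply: big_ind => // j _.
  elim: (m j) => [|k IH]; rewrite ?expr0 // exprS; apply: TM => // u.
  rewrite !ractX !mono_act1 mderivX mnm1E ractZ ractX.
  have [_ _ /(_ i j u) /eqP] := hW; rewrite subr_eq addrC => /eqP ->.
  congr (_ + _); rewrite [j == i]eq_sym; case: eqVneq => [->|_]; last by rewrite scale0r.
  by rewrite submm mono_act0 scale1r.
elim/mpolyind: p v => [|c m p _ _ IH] v.
  by rewrite mderiv0 !ract0 linear0 addr0.
rewrite mderivD mderivZ !ractD !ractZ linearD linearZ /= IH TX scalerDr.
by rewrite addrACA.
Qed.

(* [M] as a module over the polynomial ring; the proof [hW] that makes the
   action multiplicative is a parameter of the type. *)
Definition polynomial_module (hW : weyl_module_rel xop dop) : Type := M.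
HB.instance Definition _ hW := GRing.Zmodule.copy (polynomial_module hW) M.

Section Instances.
Variable hW : weyl_module_rel xop dop.
Local Notation V := (polynomial_module hW).

Lemma ract_assoc (p q : R) (v : V) : ract xop p (ract xop q v) = ract xop (p * q) v.
Proof. by rewrite (ractM hW). Qed.

Lemma ract_id : left_id 1 (ract xop : R -> V -> V).
Proof. by move=> v; apply: ract1. Qed.

Lemma ract_distrr : right_distributive (ract xop : R -> V -> V) +%R.
Proof. by move=> p u v; apply: linearD. Qed.

Lemma ract_distrl (v : V) : {morph (fun p => ract xop p v : V) : p q / p + q}.
Proof. by move=> p q; apply: ractD. Qed.

HB.instance Definition _ := GRing.Zmodule_isLmodule.Build R V
  ract_assoc ract_id ract_distrr ract_distrl.

Definition polynomial_module_deriv i : {additive V -> V} := dop i.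

End Instances.
End PolynomialModule.

(** * Nonvanishing of classes in top De Rham cohomology *)

Section Main.
Variables (K : fieldType) (n : nat) (M : lmodType K).
Variables (xop dop : 'I_n -> {linear M -> M}).
Hypothesis char0 : [pchar K] =i pred0.
Hypothesis hW : weyl_module_rel xop dop.
Variable P : {mpoly K[n]} -> Prop.
Hypothesis isoP : max_isolated xop P.
Local Notation V := (polynomial_module hW).
Local Notation d := (polynomial_module_deriv hW).

Let maxP : is_maximal_ideal P. Proof. by case: isoP. Qed.

Lemma deriv_leibniz i (p : {mpoly K[n]}) (v : V) :
  d i (p *: v) = p *: d i v + p^`M(i) *: v.
Proof. exact: dop_ract. Qed.

Lemma torsion_deriv i (v : V) : torsion P v -> torsion P (d i v).
Proof.
move=> tv p Pp; have [m Hm] := tv p Pp; exists m.+1.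
have Hm1 : p ^+ m.+1 *: v = 0 by rewrite exprS -scalerA Hm scaler0.
move: (congr1 (d i) Hm1); rewrite deriv_leibniz raddf0 mderiv_expr.
rewrite -mulr_natl mulrCA mulrC -[X in _ + X]scalerA -scalerA Hm.
by rewrite !scaler0 addr0.
Qed.

(** The square is needed because the derivative of [f ^+ 2] retains a factor [f], which kills
    [v]. *)
Lemma cotorsion_deriv i (v : V) : cotorsion P v -> cotorsion P (d i v).
Proof.
move=> [f nPf fv]; exists (f ^+ 2); first exact: prime_ideal_expr.
have f2v : f ^+ 2 *: v = 0 by rewrite expr2 -scalerA fv scaler0.
move: (congr1 (d i) f2v); rewrite deriv_leibniz raddf0 mderiv_expr expr1.
rewrite -mulr_natl mulrCA mulrC -[X in _ + X]scalerA fv.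
by rewrite !scaler0 addr0.
Qed.

Lemma max_isolated_ann_min (Q : {mpoly K[n]} -> Prop) (u : V) : is_prime_ideal Q ->
  (forall p, Q p <-> p *: u = 0) -> (forall p, Q p -> P p) -> forall p, P p -> Q p.
Proof. by case: isoP => _ _ H pQ Qu; apply: H; split=> //; exists u. Qed.

(** The term [c] will absorb the generators belonging to the other primes. Splitting each [w i]
    makes [v] minus the derivatives of the torsion parts both torsion and cotorsion, hence 0, so [v]
    is a sum of derivatives of torsion elements. *)
Lemma isolated_not_deriv (v : V) (w : 'I_n -> V) (c : V) :
  (forall p, P p -> p *: v = 0) -> cotorsion P c ->
  v + c = \sum_i d i (w i) -> v = 0.
Proof.
move=> Pv cc E.
have [G HG] := choice (fun i => separable_univariate i char0 maxP).
have [a Ha] := choice (fun i => torsion_split maxP max_isolated_ann_min (w i)).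
have [b Hb] := choice Ha.
have Ev : v - \sum_i d i (a i) = \sum_i d i (b i) - c.
  apply/eqP; rewrite subr_eq addrAC -big_split /= eq_sym subr_eq; apply/eqP.
  rewrite E; apply: eq_bigr => i _.
  by have [_ _ ->] := Hb i; rewrite raddfD addrC.
have tv : torsion P v by move=> p Pp; exists 1%N; rewrite expr1 Pv.
have tD u u' : torsion P u -> torsion P u' -> torsion P (u + u' : V) by apply: torsionD.
have cD u u' : cotorsion P u -> cotorsion P u' -> cotorsion P (u + u' : V) by apply: cotorsionD.
have tN u : torsion P u -> torsion P (- u : V) by rewrite -scaleN1r; apply: torsionZ.
have cN u : cotorsion P u -> cotorsion P (- u : V) by rewrite -scaleN1r; apply: cotorsionZ.
have t0 : torsion P (0 : V) by rewrite -(scale0r v); apply: torsionZ.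
have c0 : cotorsion P (0 : V) by apply: cotorsion0.
have Ev0 : v - \sum_i d i (a i) = 0.
  apply: (torsion_cotorsion maxP); last rewrite Ev.
    apply/tD/tN => //; apply: big_ind => // i _; apply: torsion_deriv; by case: (Hb i).
  apply/cD/cN => //; apply: big_ind => // i _; apply: cotorsion_deriv; by case: (Hb i).
apply: (@common_kernel_no_deriv _ _ V d char0 _ deriv_leibniz G _ _
         (index_enum 'I_n) (torsion P) v a) => //.
- by have [_ dC _] := hW => i j u; apply: dC.
- by move=> i; case: (HG i).
- by move=> i j; case: (HG i) => _ _; apply.
- exact: index_enum_uniq.
- exact: torsionZ.
- by move=> i u _; apply: torsion_deriv.
- by move=> i u _ tu; apply: tu; case: (HG i).
- by move=> i _; apply: Pv; case: (HG i).
- by move=> i; case: (Hb i).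
- by apply/eqP; rewrite -subr_eq0 Ev0.
Qed.

End Main.

Theorem theorem5 (K : fieldType) (hK : [pchar K] =i pred0) (n : nat)
  (M : lmodType K) (xop dop : 'I_n -> {linear M -> M})
  (hW : weyl_module_rel xop dop) (hhol : holonomic xop dop)
  (k : nat) (P : 'I_k -> {mpoly K[n]} -> Prop)
  (hP : forall j, max_isolated xop (P j))
  (hdist : forall j j', j <> j' -> ~ (forall p, P j p <-> P j' p)) :
  exists v : 'I_k -> M, indep_mod_derivs dop v.
Proof.
have exv j : exists v : M, forall p, P j p <-> ract xop p v = 0.
  by case: (hP j) => _ [_ [v Hv]] _; exists v.
have [v Hv] := choice exv; exists v => c [w E] j.
have maxP j' : is_maximal_ideal (P j') by case: (hP j').
pose V := polynomial_module hW.
(* Distinct maximal ideals are not nested, so some element of [P j'] lies outside [P j], and it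
   kills [v j']. *)
have cot j' : j' != j -> cotorsion (P j) (v j' : V).
  move=> jj'; apply: contrapT => H.
  have sub p : P j' p -> P j p.
    move=> Pp; apply: contrapT => nPp; apply: H.
    by exists p => //; apply/Hv.
  have [_ _ Pmax] := maxP j'; have [idP P1 _] := maxP j.
  by case: (Pmax _ idP sub) => // EP; apply: (hdist j j'); [apply/eqP; rewrite eq_sym|].
(* Seen from [P j], a linear relation among the classes is one term killed by [P j] plus a cotorsion
   remainder. *)
have E0 : (c j)%:MP *: (v j : V) = 0.
  apply: (@isolated_not_deriv _ _ _ _ _ hK hW (P j) (hP j) _ w
           (\sum_(j' | j' != j) (c j')%:MP *: (v j' : V))).
  - by move=> p Pp; rewrite scalerA mulrC -scalerA (_ : p *: _ = 0) ?scaler0 //; apply/Hv.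
  - apply: big_ind => [|x y|j' jj']; [exact: cotorsion0 | exact: cotorsionD |].
    by apply: cotorsionZ; apply: cot.
  - rewrite -E [RHS](bigD1 j) //=; congr (_ + _); first exact: ractC.
    by apply: eq_bigr => j' _; apply: ractC.
(* A nonzero [c j] would give [v j = 0], putting 1 in its annihilator [P j]. *)
apply/eqP; apply: contrapT => /negP cj; have [_ P1 _] := maxP j; apply: P1.
apply/Hv; rewrite ract1 -[v j]scale1r -(mulVf cj) -scalerA.
by rewrite (_ : c j *: v j = 0) ?scaler0 // -[RHS]E0; apply/esym/ractC.
Qed.
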